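(* Let $X$ be a proper CAT(0) space and $G<\mathrm{Isom}(X)$ a closed subgroup acting cocompactly and minimally on $X$. If $G$ is unimodular, then every point of $\partial X$ fixed by $G$ is contained in the boundary of the Euclidean factor of $X$.
   Context: A metric space is proper if its closed balls are compact; $\mathrm{Isom}(X)$ carries the compact-open topology (a locally compact group); $\partial X$ is the visual boundary. An action on $X$ is minimal if $X$ has no non-empty closed convex invariant proper subset, and cocompact if the translates of some compact subset cover $X$. The Euclidean factor of $X$ is the factor $\mathbf{R}^n$ in the canonical decomposition $X\cong\mathbf{R}^n\times X'$ where $X'$ does not split off a factor $\mathbf{R}$ (possibly $n=0$, in which case the boundary of the Euclidean factor is empty); its boundary is viewed as a subset of $\partial X$. *)

(* Defs.v *)
From HB Require Import structures.
From mathcomp Require Import all_boot all_order all_algebra.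
From mathcomp Require Import all_classical all_reals all_analysis.

Set Implicit Arguments.
Unset Strict Implicit.
Unset Printing Implicit Defensive.

Import Order.TTheory GRing.Theory Num.Theory.
Import numFieldNormedType.Exports.

Local Open Scope classical_set_scope.
Local Open Scope ring_scope.

(* Continuity of the group operations is not recorded in this structure: it
   plays no role in the definition of a Haar measure. *)
#[short(type="groupTopologicalType")]
HB.structure Definition GroupTopological :=
  {T of Group T & PointedTopological T}.

Section Haar.
Context {R : realType} {T : groupTopologicalType}.

Local Notation borel := (g_sigma_algebraType (@open T)).
Local Notation measurable := ((@open T).-sigma.-measurable).

Implicit Type mu : {measure set borel -> \bar R}.

Definition radon_measure mu : Prop :=
  [/\ forall K : set T, compact K -> (mu K < +oo)%E,
      forall A : set T, measurable A ->
        mu A = ereal_inf [set mu U | U in [set U : set T | open U /\ A `<=` U]]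
    & forall U : set T, open U ->
        mu U =
        ereal_sup [set mu K | K in [set K : set T | compact K /\ K `<=` U]]].

Definition left_invariant mu : Prop :=
  forall (g : T) (A : set T), measurable A ->
    mu [set (g * h)%g | h in A] = mu A.

Definition right_invariant mu : Prop :=
  forall (g : T) (A : set T), measurable A ->
    mu [set (h * g)%g | h in A] = mu A.

Definition left_haar_measure mu : Prop :=
  [/\ radon_measure mu, mu [set: T] <> 0%E & left_invariant mu].

End Haar.

Definition unimodular (R : realType) (T : groupTopologicalType) : Prop :=
  exists mu : {measure set (g_sigma_algebraType (@open T)) -> \bar R},
    left_haar_measure mu /\ right_invariant mu.

Definition subgroup (T : groupTopologicalType) (G : groupClosed T) : Type :=
  {g : T | g \in G}.

Section Subgroup.
Context {T : groupTopologicalType} (G : groupClosed T).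

HB.instance Definition _ := SubChoice.copy (subgroup G) {g : T | g \in G}.

Lemma subgroup_group_closed : group_closed G.
Proof. by split=> [|g h gG hG]; [exact: gpred1 | exact: gpredF]. Qed.

HB.instance Definition _ :=
  SubChoice_isSubGroup.Build T (mem G) (subgroup G) subgroup_group_closed.
HB.instance Definition _ := isPointed.Build (subgroup G) 1%g.
HB.instance Definition _ :=
  Topological.copy (subgroup G) (initial_topology (val : subgroup G -> T)).

End Subgroup.

Record Isom (R : realType) (X : metricType R) := Isometry {
  isometry_fun :> X -> X;
  isometry_mdist : forall x y,
    mdist (isometry_fun x) (isometry_fun y) = mdist x y;
  isometry_bij : bijective isometry_fun }.

Section IsometryGroup.
Context {R : realType} (X : metricType R).
Implicit Types f g h : Isom X.

HB.instance Definition _ := gen_eqMixin (Isom X).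
HB.instance Definition _ := gen_choiceMixin (Isom X).

Lemma isometry_eqP f g : f = g <-> f =1 g.
Proof.
split=> [->//|]; case: f g => [f fd fb] [g gd gb] /= /funext fg.
subst g; congr Isometry; exact: Prop_irrelevance.
Qed.

Definition isometry_id : Isom X :=
  @Isometry R X id (fun _ _ => erefl) (inv_bij (fun=> erefl)).

Lemma isometry_comp_mdist f g x y :
  mdist ((f \o g) x) ((f \o g) y) = mdist x y.
Proof. by rewrite /= !isometry_mdist. Qed.

Definition isometry_comp f g : Isom X :=
  Isometry (isometry_comp_mdist f g)
    (bij_comp (isometry_bij f) (isometry_bij g)).

Lemma isometry_inv_subproof f :
  exists f' : Isom X, cancel f f' /\ cancel f' f.
Proof.
have [f' ff' f'f] := isometry_bij f.
have d x y : mdist (f' x) (f' y) = mdist x y.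
  by rewrite -(isometry_mdist f) !f'f.
by exists (Isometry d (Bijective f'f ff')).
Qed.

Definition isometry_inv f : Isom X := sval (cid (isometry_inv_subproof f)).

Lemma isometry_invK f : cancel f (isometry_inv f).
Proof. by rewrite /isometry_inv; case: cid => f' []. Qed.

Lemma isometry_invVK f : cancel (isometry_inv f) f.
Proof. by rewrite /isometry_inv; case: cid => f' []. Qed.

Lemma isometry_compA : associative isometry_comp.
Proof. by move=> f g h; apply/isometry_eqP. Qed.

Lemma isometry_comp1f : left_id isometry_id isometry_comp.
Proof. by move=> f; apply/isometry_eqP. Qed.

Lemma isometry_compf1 : right_id isometry_id isometry_comp.
Proof. by move=> f; apply/isometry_eqP. Qed.

Lemma isometry_compVf : left_inverse isometry_id isometry_inv isometry_comp.
Proof. by move=> f; apply/isometry_eqP => x /=; rewrite isometry_invK. Qed.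

Lemma isometry_compfV : right_inverse isometry_id isometry_inv isometry_comp.
Proof. by move=> f; apply/isometry_eqP => x /=; rewrite isometry_invVK. Qed.

HB.instance Definition _ := isGroup.Build (Isom X)
  isometry_compA isometry_comp1f isometry_compf1
  isometry_compVf isometry_compfV.

HB.instance Definition _ := isPointed.Build (Isom X) isometry_id.

HB.instance Definition _ := Topological.copy (Isom X)
  (@initial_topology (Isom X) {compact-open, X -> X} (@isometry_fun R X)).

End IsometryGroup.

Section CAT0.
Context {R : realType}.

(* The library norm on ['rV_n] is the supremum norm, hence this definition. *)
Definition euclidean_dist n (v w : 'rV[R]_n) : R :=
  Num.sqrt (\sum_(i < n) (v 0 i - w 0 i) ^+ 2).

Definition euclidean_segment n (v w : 'rV[R]_n) : set 'rV[R]_n :=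
  [set (1 - k) *: v + k *: w | k in `[0, 1]].

Definition proper_space (X : metricType R) : Prop :=
  forall (x : X) (r : R), compact [set y | mdist x y <= r].

(* Only the values of [c] on [[0, mdist x y]] are relevant. *)
Definition geodesic_segment (X : metricType R) (x y : X) (c : R -> X) : Prop :=
  [/\ c 0 = x, c (mdist x y) = y &
      {in `[0, mdist x y] &, forall s t, mdist (c s) (c t) = `|s - t|}].

Definition geodesic_space (X : metricType R) : Prop :=
  forall x y : X, exists c, geodesic_segment x y c.

(* Any two distinct sides of a geodesic triangle share a vertex, called [x]
   below, and points on the same side satisfy the comparison inequality
   trivially, so that it is enough to compare points on the sides [c] from [x]
   to [y] and [c'] from [x] to [z]. *)
Definition CAT0 (X : metricType R) : Prop :=
  geodesic_space X /\
  forall (x y z : X) (c c' : R -> X) (x' y' z' : 'rV[R]_2),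
    geodesic_segment x y c -> geodesic_segment x z c' ->
    euclidean_dist x' y' = mdist x y ->
    euclidean_dist x' z' = mdist x z ->
    euclidean_dist y' z' = mdist y z ->
    forall (s t : R) (p' q' : 'rV[R]_2),
      s \in `[0, mdist x y] -> t \in `[0, mdist x z] ->
      euclidean_segment x' y' p' -> euclidean_dist x' p' = s ->
      euclidean_segment x' z' q' -> euclidean_dist x' q' = t ->
      mdist (c s) (c' t) <= euclidean_dist p' q'.

Definition geodesically_convex (X : metricType R) (C : set X) : Prop :=
  forall (x y : X) (c : R -> X), C x -> C y -> geodesic_segment x y c ->
  forall t : R, t \in `[0, mdist x y] -> C (c t).

Definition invariant (X : metricType R) (G : set (Isom X)) (C : set X) :
  Prop := forall g x, G g -> C x -> C (g x).

Definition minimal_action (X : metricType R) (G : set (Isom X)) : Prop :=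
  forall C : set X, C !=set0 -> closed C -> geodesically_convex C ->
  invariant G C -> C = [set: X].

Definition cocompact_action (X : metricType R) (G : set (Isom X)) : Prop :=
  exists2 K : set X, compact K & \bigcup_(g in G) [set g x | x in K] = [set: X].

(* Only the values of [r] on [[0, +oo[] are relevant: rays which agree there
   are asymptotic, hence define the same point at infinity. *)
Definition geodesic_ray (X : metricType R) (r : R -> X) : Prop :=
  {in `[0, +oo[ &, forall s t, mdist (r s) (r t) = `|s - t|}.

Definition asymptotic (X : metricType R) (r r' : R -> X) : Prop :=
  exists M : R, forall t : R, 0 <= t -> mdist (r t) (r' t) <= M.

Definition asymptote_class (X : metricType R) (r : R -> X) : set (R -> X) :=
  [set r' | geodesic_ray r' /\ asymptotic r r'].

Definition visual_boundary (X : metricType R) : set (set (R -> X)) :=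
  [set asymptote_class r | r in @geodesic_ray X].
Arguments visual_boundary X _ : clear implicits.

Definition boundary_act (X : metricType R) (g : Isom X)
  (xi : set (R -> X)) : set (R -> X) := [set g \o r | r in xi].

Definition fixed_at_infinity (X : metricType R) (G : set (Isom X))
  (xi : set (R -> X)) : Prop := forall g, G g -> boundary_act g xi = xi.

(* [phi] is an isometry from the product of [R^n] and [Y], endowed with the
   l2 product metric, onto [X]; injectivity follows from the first clause. *)
Definition euclidean_splitting (X : metricType R) n (Y : metricType R)
    (phi : 'rV[R]_n -> Y -> X) : Prop :=
  (forall v w y z, mdist (phi v y) (phi w z) =
     Num.sqrt (euclidean_dist v w ^+ 2 + mdist y z ^+ 2)) /\
  (forall x, exists v y, phi v y = x).

Definition splits_line (X : metricType R) : Prop :=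
  exists (Y : metricType R) (phi : 'rV[R]_1 -> Y -> X), euclidean_splitting phi.

Definition canonical_decomposition (X : metricType R) n (Y : metricType R)
    (phi : 'rV[R]_n -> Y -> X) : Prop :=
  euclidean_splitting phi /\ ~ splits_line Y.

(* The points at infinity represented by a ray contained in some flat
   [R^n * {y}]. The canonical decomposition is unique, in that the partition of
   [X] into these flats does not depend on it. *)
Definition euclidean_factor_boundary (X : metricType R) : set (set (R -> X)) :=
  [set xi | visual_boundary X xi /\
    exists (n : nat) (Y : metricType R) (phi : 'rV[R]_n -> Y -> X),
      canonical_decomposition phi /\
      exists2 r, xi r &
        exists y, forall t : R, 0 <= t -> exists v, r t = phi v y].

End CAT0.

Arguments visual_boundary {R} X _.
Arguments euclidean_factor_boundary {R} X _.

(* Main.v *)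
(* Let [r] be a ray towards the fixed point [xi].  For [g] in [G] the rays [g r]
   and [r] are asymptotic, so that [mdist (g (r t)) (r t)] is nonincreasing in
   [t], and the Haar measure [V (r t)] of the compact set of those [g] which
   displace [r t] by at most [e] is nondecreasing.  As [G] is unimodular, [V] is
   invariant under [G], hence bounded by cocompactness.  Cocompactness also
   yields elements [k n] of [G] such that the rays [k n (r (n + s))] accumulate
   at a geodesic line [c] ending at [xi], along which [V] must be constant.
   Since nonempty open sets of isometries have positive measure, every [g]
   displaces all the points of [c] by the same amount: the lines [g c] are
   parallel to [c].  The union of the lines parallel to [c] is closed, convex
   and invariant, thus equal to [X] by minimality, and [X] splits as a product
   of [c] and of a cross-section.  It remains to split off further lines as long
   as possible. *)

Require Import Defs.
From HB Require Import structures.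
From mathcomp Require Import all_boot all_order all_algebra.
From mathcomp Require Import all_classical all_reals all_analysis.
From mathcomp Require Import finmap ring lra.

Set Implicit Arguments.
Unset Strict Implicit.
Unset Printing Implicit Defensive.

Import Order.TTheory GRing.Theory Num.Theory.
Import numFieldNormedType.Exports.

Local Open Scope classical_set_scope.
Local Open Scope ring_scope.

(** * Comparison geometry *)

Section Comparison.
Context {R : realType}.

Definition vec2 (a b : R) : 'rV[R]_2 := \row_i (if i == 0 then a else b).

Lemma euclidean_dist_vec2 (a b u v : R) :
  euclidean_dist (vec2 a b) (vec2 u v) = Num.sqrt ((a - u) ^+ 2 + (b - v) ^+ 2).
Proof. by rewrite /euclidean_dist !big_ord_recl big_ord0 !mxE /= addr0. Qed.

Lemma vec2_segment (a b k : R) : 0 <= k <= 1 ->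
  euclidean_segment (vec2 0 0) (vec2 a b) (vec2 (k * a) (k * b)).
Proof.
move=> k01; exists k; first by rewrite /= in_itv.
by apply/rowP => i; rewrite !mxE; case: ifP => _; rewrite mulr0 add0r.
Qed.

(** Place the base of length [a] on the first axis: the law of cosines gives the abscissa [u] of the
    apex, and the triangle inequalities give [|u| <= b], so that the ordinate exists. *)
Lemma comparison_triangle (a b c : R) : 0 <= a -> 0 <= b -> 0 <= c ->
  a <= b + c -> b <= a + c -> c <= a + b ->
  exists u v : R, [/\ u ^+ 2 + v ^+ 2 = b ^+ 2 &
                      (a - u) ^+ 2 + v ^+ 2 = c ^+ 2].
Proof.
move=> a0 b0 c0 abc bac cab; have [a_eq0|an0] := eqVneq a 0.
  exists b, 0; have -> : c = b by lra.
  by split; rewrite ?a_eq0; ring.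
set u := (a ^+ 2 + b ^+ 2 - c ^+ 2) / (2 * a).
have uE : 2 * a * u = a ^+ 2 + b ^+ 2 - c ^+ 2 by rewrite /u; field.
have a_gt0 : 0 < a by rewrite lt_neqAle eq_sym an0.
have ub : u <= b.
  have : 2 * a * u <= 2 * a * b by rewrite uE; nra.
  by rewrite ler_pM2l //; lra.
have bu : - b <= u.
  have : 2 * a * (- b) <= 2 * a * u by rewrite uE; nra.
  by rewrite ler_pM2l //; lra.
have v0 : 0 <= b ^+ 2 - u ^+ 2 by nra.
exists u, (Num.sqrt (b ^+ 2 - u ^+ 2)); rewrite sqr_sqrtr //.
split; first by ring.
by transitivity (a ^+ 2 - 2 * a * u + b ^+ 2); [ring | rewrite uE; ring].
Qed.

End Comparison.

Section Geometry.
Context {R : realType} (X : metricType R).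
Implicit Types (x y z p m n : X) (c r : R -> X).

(** The point at ratio [k] of a geodesic from [x] to [y], given by distances alone so that no
    parametrization has to be carried along. *)
Definition between (k : R) x y m :=
  mdist x m = k * mdist x y /\ mdist m y = (1 - k) * mdist x y.

Definition geodesic_line c := forall s t, mdist (c s) (c t) = `|s - t|.

Definition parallel c c' := exists M : R, forall t, mdist (c t) (c' t) <= M.

Lemma between_sym k x y m : between k x y m -> between (1 - k) y x m.
Proof.
rewrite /between => -[xm my]; rewrite metric_sym my (metric_sym m) xm.
by rewrite (metric_sym y x); split=> //; congr (_ * _); ring.
Qed.

Lemma between_refl k x : between k x x x.
Proof. by rewrite /between mdistxx !mulr0. Qed.

Lemma geodesic_between x y c k : 0 <= k <= 1 -> geodesic_segment x y c ->
  between k x y (c (k * mdist x y)).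
Proof.
move=> /andP[k0 k1] [c0 c1 cd]; have d0 := mdist_ge0 x y.
have kd0 : 0 <= k * mdist x y by rewrite mulr_ge0.
have kd1 : k * mdist x y <= mdist x y by rewrite ler_piMl.
have zz : 0 \in `[0, mdist x y] by rewrite in_itv /= lexx d0.
have dd : mdist x y \in `[0, mdist x y] by rewrite in_itv /= lexx d0.
have kk : k * mdist x y \in `[0, mdist x y] by rewrite in_itv /= kd0 kd1.
split.
  by rewrite -{1}c0 cd // sub0r normrN ger0_norm.
by rewrite -{2}c1 cd // distrC ger0_norm ?subr_ge0 // mulrBl mul1r.
Qed.

Hypothesis catX : CAT0 X.

(** The CAT(0) inequality with the planar distance expanded by the law of cosines: the last bracket
    is twice the inner product of the two comparison sides. *)
Lemma cat0_compare x y z c c' (k l : R) :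
  geodesic_segment x y c -> geodesic_segment x z c' ->
  0 <= k <= 1 -> 0 <= l <= 1 ->
  mdist (c (k * mdist x y)) (c' (l * mdist x z)) ^+ 2 <=
  k ^+ 2 * mdist x y ^+ 2 + l ^+ 2 * mdist x z ^+ 2 -
  k * l * (mdist x y ^+ 2 + mdist x z ^+ 2 - mdist y z ^+ 2).
Proof.
move=> gc gc' k01 l01.
have a0 := mdist_ge0 x y; have b0 := mdist_ge0 x z; have c0 := mdist_ge0 y z.
have [u [v [uvb uvc]]] : exists u v : R,
    [/\ u ^+ 2 + v ^+ 2 = mdist x z ^+ 2 &
        (mdist x y - u) ^+ 2 + v ^+ 2 = mdist y z ^+ 2].
  apply: comparison_triangle => //.
  - by rewrite (metric_sym y z) metric_triangle.
  - by rewrite metric_triangle.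
  - by rewrite (metric_sym x y) metric_triangle.
set a := mdist x y in a0 uvc gc *; set b := mdist x z in b0 uvb gc' *.
have [k0 k1] := andP k01; have [l0 l1] := andP l01.
have := catX.2 x y z c c' (vec2 0 0) (vec2 a 0) (vec2 u v) gc gc'.
rewrite !euclidean_dist_vec2.
have -> : Num.sqrt ((a - u) ^+ 2 + (0 - v) ^+ 2) = mdist y z.
  by rewrite sub0r sqrrN uvc sqrtr_sqr ger0_norm.
have -> : Num.sqrt ((0 - a) ^+ 2 + (0 - 0) ^+ 2) = a.
  by rewrite subr0 expr0n addr0 sub0r sqrrN sqrtr_sqr ger0_norm.
have -> : Num.sqrt ((0 - u) ^+ 2 + (0 - v) ^+ 2) = b.
  by rewrite !sub0r !sqrrN uvb sqrtr_sqr ger0_norm.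
move=> /(_ erefl erefl erefl (k * a) (l * b) _ _ _ _
   (vec2_segment a 0 k01) _ (vec2_segment u v l01)).
rewrite !euclidean_dist_vec2 !sub0r !sqrrN => H.
have {}H : mdist (c (k * a)) (c' (l * b)) <=
    Num.sqrt ((k * a - l * u) ^+ 2 + (k * 0 - l * v) ^+ 2).
  apply: H.
  - by rewrite in_itv /= mulr_ge0 //= ler_piMl.
  - by rewrite in_itv /= mulr_ge0 //= ler_piMl.
  - by rewrite mulr0 expr0n addr0 sqrtr_sqr ger0_norm // mulr_ge0.
  - by rewrite !exprMn -mulrDr uvb -exprMn sqrtr_sqr ger0_norm // mulr_ge0.
rewrite -(@ler_pXn2r _ 2) ?nnegrE ?mdist_ge0 ?sqrtr_ge0 // in H.
apply: le_trans H _; rewrite sqr_sqrtr; last by rewrite addr_ge0 // sqr_ge0.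
rewrite le_eqVlt; apply/orP; left; apply/eqP.
rewrite -uvb -uvc; ring.
Qed.

Lemma between_exists x y (k : R) : 0 <= k <= 1 -> exists m, between k x y m.
Proof.
by move=> k01; have [c gc] := catX.1 x y; exists (c (k * mdist x y));
  exact: geodesic_between.
Qed.

(** Stewart's formula for the comparison triangle: the case of [cat0_compare] where the second point
    is the vertex [p] itself. *)
Lemma cat0_geodesic x y c p (k : R) : 0 <= k <= 1 -> geodesic_segment x y c ->
  mdist p (c (k * mdist x y)) ^+ 2 <=
  (1 - k) * mdist p x ^+ 2 + k * mdist p y ^+ 2 - k * (1 - k) * mdist x y ^+ 2.
Proof.
move=> k01 gc; have [c' gc'] := catX.1 x p.
have l01 : 0 <= (1 : R) <= 1 by rewrite ler01 lexx.
have := cat0_compare gc gc' k01 l01; rewrite mul1r.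
have [_ -> _] := gc'; rewrite metric_sym (metric_sym x p) (metric_sym y p).
by move/le_trans; apply; rewrite le_eqVlt; apply/orP; left; apply/eqP; ring.
Qed.

(** Taking [m] for [p] in [cat0_geodesic] makes the right-hand side vanish. *)
Lemma between_geodesic x y c m (k : R) : 0 <= k <= 1 ->
  geodesic_segment x y c -> between k x y m -> m = c (k * mdist x y).
Proof.
move=> k01 gc [xm my]; have := cat0_geodesic m k01 gc.
rewrite (metric_sym m x) xm my.
have -> : (1 - k) * (k * mdist x y) ^+ 2 + k * ((1 - k) * mdist x y) ^+ 2 -
  k * (1 - k) * mdist x y ^+ 2 = 0 by ring.
move=> le0; apply: mdist_positivity.
by apply/eqP; rewrite -sqrf_eq0 eq_le le0 sqr_ge0.
Qed.

Lemma between_uniq x y m n (k : R) : 0 <= k <= 1 ->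
  between k x y m -> between k x y n -> m = n.
Proof.
move=> k01 xm xn; have [c gc] := catX.1 x y.
by rewrite (between_geodesic k01 gc xm) -(between_geodesic k01 gc xn).
Qed.

Lemma cat0_between x y m p (k : R) : 0 <= k <= 1 -> between k x y m ->
  mdist p m ^+ 2 <=
  (1 - k) * mdist p x ^+ 2 + k * mdist p y ^+ 2 - k * (1 - k) * mdist x y ^+ 2.
Proof.
move=> k01 xm; have [c gc] := catX.1 x y.
by rewrite (between_geodesic k01 gc xm); exact: cat0_geodesic.
Qed.

Lemma between_contract x y z m n (k : R) : 0 <= k <= 1 ->
  between k x y m -> between k x z n -> mdist m n <= k * mdist y z.
Proof.
move=> k01 xm xn; have [c gc] := catX.1 x y; have [c' gc'] := catX.1 x z.
have := cat0_compare gc gc' k01 k01; have [k0 _] := andP k01.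
rewrite -(between_geodesic k01 gc xm) -(between_geodesic k01 gc' xn) => H.
rewrite -(@ler_pXn2r _ 2) ?nnegrE ?mulr_ge0 ?mdist_ge0 //.
by apply: le_trans H _; rewrite le_eqVlt; apply/orP; left; apply/eqP; ring.
Qed.

(** The diagonal from [x] to [y'] cuts the quadrilateral into two triangles; [between_contract]
    applies to each, from opposite ends. *)
Lemma between_convex x y x' y' m n (k : R) : 0 <= k <= 1 ->
  between k x y m -> between k x' y' n ->
  mdist m n <= (1 - k) * mdist x x' + k * mdist y y'.
Proof.
move=> k01 xm xn; have [q xq] := between_exists x y' k01.
have k01' : 0 <= 1 - k <= 1 by lra.
have := between_contract k01' (between_sym xq) (between_sym xn).
have := between_contract k01 xm xq; have := metric_triangle m q n; lra.
Qed.

Lemma mdist_between_convex x y m p (k : R) : 0 <= k <= 1 -> between k x y m ->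
  mdist p m <= (1 - k) * mdist p x + k * mdist p y.
Proof. by move=> k01; exact: between_convex (between_refl k p). Qed.

(** Compare [y] and [w] with the midpoint [m] of the diagonal from [x] to [z]; the square of the sum
    of their distances to [m] is at most twice the sum of the squares. *)
Lemma parallelogram_ineq x y z w :
  mdist x z ^+ 2 + mdist y w ^+ 2 <=
  mdist x y ^+ 2 + mdist y z ^+ 2 + mdist z w ^+ 2 + mdist w x ^+ 2.
Proof.
have k01 : 0 <= (2^-1 : R) <= 1 by lra.
have [m xm] := between_exists x z k01.
have := cat0_between y k01 xm; have := cat0_between w k01 xm.
rewrite (metric_sym y x) (metric_sym w z) => H1 H2.
have := metric_triangle y m w; rewrite (metric_sym m w) => tri.
have := mdist_ge0 y w => yw0.
have sq : mdist y w ^+ 2 <= (mdist y m + mdist w m) ^+ 2.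
  by rewrite ler_pXn2r ?nnegrE //; apply: le_trans tri.
have : 0 <= (mdist y m - mdist w m) ^+ 2 by rewrite sqr_ge0.
lra.
Qed.

End Geometry.

(** * Lines and flat strips *)

(** With [g 1 = 0] the function is periodic, so its bound on the unit interval holds everywhere; a
    large multiple of a nonzero value would exceed it. *)
Lemma additive_bounded_growth_eq0 (R : realType) (g : R -> R) (A B : R) :
  (forall x y, g (x + y) = g x + g y) -> g 1 = 0 ->
  (forall x, `|g x| <= A + B * `|x|) -> forall x, g x = 0.
Proof.
move=> gD g1 gb.
have g0 : g 0 = 0 by have := gD 0 0; rewrite addr0; lra.
have gMn x n : g (x *+ n) = g x *+ n.
  by elim: n => [|n IH]; rewrite ?mulr0n // !mulrS gD IH.
have gn n : g n%:R = 0 by rewrite gMn g1 mul0rn.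
have gN x : g (- x) = - g x by have := gD x (- x); rewrite subrr g0; lra.
have gbound x : 0 <= x -> `|g x| <= A + `|B|.
  move=> x0; have /andP[x1 x2] := truncn_itv x0.
  have -> : g x = g (x - (Num.truncn x)%:R) by rewrite gD gN gn; ring.
  apply: le_trans (gb _) _; rewrite lerD2l.
  apply: le_trans (ler_norm _) _; rewrite normrM normr_id ler_piMr //.
  by rewrite ger0_norm ?subr_ge0 // lerBlDr addrC natr1 ltW.
suff gpos x : 0 <= x -> g x = 0.
  move=> x; have [/gpos //|x0] := leP 0 x.
  by rewrite -[x]opprK gN gpos ?oppr0 // oppr_ge0 ltW.
move=> x0; apply/eqP; rewrite -normr_eq0 eq_le normr_ge0 andbT leNgt.
apply/negP => gx0.
pose n := (Num.truncn ((A + `|B|) / `|g x|)).+1.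
have := gbound (x *+ n) (mulrn_wge0 n x0); rewrite gMn normrMn leNgt.
move=> /negP; apply; rewrite -mulr_natr mulrC -ltr_pdivrMr //.
have AB0 : 0 <= A + `|B| by apply: le_trans (gbound 0 (lexx 0)).
by have /andP[] := truncn_itv (divr_ge0 AB0 (ltW gx0)).
Qed.

(** Jensen's functional equation: subtracting the affine interpolation at 0 and 1 leaves an additive
    function, to which [additive_bounded_growth_eq0] applies. *)
Lemma midpoint_affine (R : realType) (h : R -> R) (A B : R) :
  (forall b u, h (b + u) + h (b - u) = 2 * h b) ->
  (forall b, `|h b| <= A + B * `|b|) ->
  forall b, h b = h 0 + b * (h 1 - h 0).
Proof.
move=> hmid hb; pose g b := h b - h 0 - b * (h 1 - h 0).
have gmid b u : g (b + u) + g (b - u) = 2 * g b.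
  by rewrite /g; have := hmid b u; lra.
have g0 : g 0 = 0 by rewrite /g; ring.
have g2 b : g (b + b) = 2 * g b by have := gmid b b; rewrite subrr g0; lra.
have gD x y : g (x + y) = g x + g y.
  have := gmid ((x + y) / 2) ((x - y) / 2); rewrite -g2.
  have -> : (x + y) / 2 + (x - y) / 2 = x by field.
  have -> : (x + y) / 2 - (x - y) / 2 = y by field.
  by have -> : (x + y) / 2 + (x + y) / 2 = x + y by field.
have g1 : g 1 = 0 by rewrite /g; ring.
have gb x : `|g x| <= (A + `|h 0|) + (B + `|h 1 - h 0|) * `|x|.
  rewrite /g; apply: le_trans (ler_normB _ _) _; rewrite normrM.
  have := ler_normB (h x) (h 0); have := hb x; lra.
by move=> b; have := additive_bounded_growth_eq0 gD g1 gb b; rewrite /g; lra.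
Qed.

Section Lines.
Context {R : realType} (X : metricType R).
Hypothesis catX : CAT0 X.
Implicit Types (x y z p m n : X) (c r : R -> X).

Lemma mdist_quad x y z w :
  `|mdist x y - mdist z w| <= mdist x z + mdist y w.
Proof.
have := metric_triangle x z y; have := metric_triangle z w y.
have := metric_triangle z x w; have := metric_triangle x y w.
rewrite (metric_sym z x) (metric_sym w y) ler_norml; lra.
Qed.

Lemma ray_between r u t v : geodesic_ray r -> 0 <= u -> u <= t -> t <= v ->
  u < v -> between ((t - u) / (v - u)) (r u) (r v) (r t).
Proof.
move=> rr u0 ut tv uv; have [t0 v0] : 0 <= t /\ 0 <= v by split; lra.
rewrite /between !rr ?in_itv /= ?andbT //.
rewrite !(distrC u) (distrC t v) !ger0_norm ?subr_ge0 ?(ltW uv) //.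
have vu : v - u != 0 by rewrite subr_eq0 gt_eqF.
by split; field.
Qed.

Lemma asymptotic_sym r r' : asymptotic r r' -> asymptotic r' r.
Proof. by move=> [M rM]; exists M => t t0; rewrite metric_sym rM. Qed.

Lemma asymptotic_trans r r' r'' :
  asymptotic r r' -> asymptotic r' r'' -> asymptotic r r''.
Proof.
move=> [M rM] [M' rM']; exists (M + M') => t t0.
by apply: le_trans (metric_triangle _ (r' t) _) _; apply: lerD; auto.
Qed.

(** The distance is convex in the parameter, and a bounded convex function on a half-line cannot
    increase. *)
Lemma asymptotic_nonincreasing r r' u t : geodesic_ray r -> geodesic_ray r' ->
  asymptotic r r' -> 0 <= u -> u <= t ->
  mdist (r t) (r' t) <= mdist (r u) (r' u).
Proof.
move=> rr rr' [M rM] u0 ut; rewrite leNgt; apply/negP => lt.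
set e := mdist (r t) (r' t) - mdist (r u) (r' u).
have e0 : 0 < e by rewrite subr_gt0.
have M0 : 0 <= M by apply: le_trans (mdist_ge0 _ _) (rM 0 (lexx 0)).
(* So far out that the value at [v], at most [M], contributes less than the supposed increase [e] to
   the convexity inequality at [t]. *)
set v := t + (t - u) * M / e + 1.
have q0 : 0 <= (t - u) * M / e by rewrite divr_ge0 ?mulr_ge0 ?subr_ge0 // ltW.
have tv : t <= v by rewrite /v; lra.
have uv : u < v by rewrite /v; lra.
have v0 : 0 <= v by lra.
have vu0 : 0 < v - u by lra.
set k := (t - u) / (v - u).
have k0 : 0 <= k by rewrite divr_ge0 //; lra.
have k1 : k <= 1 by rewrite ler_pdivrMr // mul1r; lra.
have k01 : 0 <= k <= 1 by rewrite k0 k1.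
have := between_convex catX k01 (ray_between rr u0 ut tv uv)
  (ray_between rr' u0 ut tv uv).
have kM : k * M < e.
  rewrite /k mulrAC ltr_pdivrMr //.
  have -> : (t - u) * M = (t - u) * M / e * e by rewrite divfK // gt_eqF.
  by rewrite mulrC ltr_pM2l // /v; lra.
have := rM v v0; have := mdist_ge0 (r u) (r' u).
have : k * mdist (r v) (r' v) <= k * M by rewrite ler_wpM2l ?rM.
rewrite /e in kM e0; have : 0 <= k * mdist (r u) (r' u).
  by rewrite mulr_ge0 ?mdist_ge0.
lra.
Qed.

Lemma line_ray c a : geodesic_line c -> geodesic_ray (fun t => c (a + t)).
Proof. by move=> lc s t _ _ /=; rewrite lc; congr `|_|; ring. Qed.

Lemma line_reverse c : geodesic_line c -> geodesic_line (fun t => c (- t)).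
Proof. by move=> lc s t /=; rewrite lc distrC; congr `|_|; ring. Qed.

Lemma line_shift c a : geodesic_line c -> geodesic_line (fun t => c (t + a)).
Proof. by move=> lc s t /=; rewrite lc; congr `|_|; ring. Qed.

Lemma parallel_sym c c' : parallel c c' -> parallel c' c.
Proof. by move=> [M cM]; exists M => t; rewrite metric_sym. Qed.

Lemma parallel_trans c c' c'' :
  parallel c c' -> parallel c' c'' -> parallel c c''.
Proof.
move=> [M cM] [M' cM']; exists (M + M') => t.
by apply: le_trans (metric_triangle _ (c' t) _) _; apply: lerD.
Qed.

Lemma parallel_refl c : parallel c c.
Proof. by exists 0 => t; rewrite mdistxx. Qed.

Lemma parallel_shift c a : geodesic_line c ->
  parallel c (fun t => c (t + a)).
Proof.
by move=> lc; exists `|a| => t; rewrite lc opprD addrA subrr sub0r normrN.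
Qed.

Lemma line_asymptotic_le c c' s t : geodesic_line c ->
  geodesic_line c' -> asymptotic c c' -> s <= t ->
  mdist (c t) (c' t) <= mdist (c s) (c' s).
Proof.
move=> lc lc' [M cM] st.
have := @asymptotic_nonincreasing _ _ 0 (t - s)
  (line_ray s lc) (line_ray s lc').
rewrite addr0 [s + _]addrC subrK; apply; rewrite ?subr_ge0 //.
exists (`|s| + M + `|s|) => u u0.
apply: le_trans (metric_triangle _ (c u) _) _; rewrite -addrA.
apply: lerD; first by rewrite lc addrK.
apply: le_trans (metric_triangle _ (c' u) _) _.
by apply: lerD; [exact: cM|rewrite lc' opprD addrCA subrr addr0 normrN].
Qed.

(** Parallel lines are asymptotic in both directions; reversing them turns the monotonicity
    around. *)
Lemma parallel_mdist c c' s t : geodesic_line c -> geodesic_line c' ->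
  parallel c c' -> mdist (c s) (c' s) = mdist (c t) (c' t).
Proof.
wlog st : s t / s <= t => [wl lc lc' cc'|lc lc' [M cM]].
  by have [/wl|/ltW/wl] := leP s t => -> //.
have as1 : asymptotic c c' by exists M => u _; exact: cM.
have as2 : asymptotic (fun u => c (- u)) (fun u => c' (- u)).
  by exists M => u _; exact: cM.
have nst : - t <= - s by rewrite lerN2.
apply/eqP; rewrite eq_le (line_asymptotic_le lc lc' as1 st) andbT.
have := line_asymptotic_le (line_reverse lc) (line_reverse lc') as2 nst.
by rewrite !opprK.
Qed.

Lemma parallel_mdist0 c c' t : geodesic_line c -> geodesic_line c' ->
  parallel c c' -> c 0 = c' 0 -> c t = c' t.
Proof.
move=> lc lc' cc' c0; apply: mdist_positivity.
by rewrite (parallel_mdist t 0 lc lc' cc') c0 mdistxx.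
Qed.

(* [c] and [c'] bound a flat strip of width [sqrt D], and [c' a] is the point
   of [c'] opposite to [c 0]. *)
Definition strip c c' (a D : R) :=
  0 <= D /\ forall s t, mdist (c s) (c' t) ^+ 2 = (t - s - a) ^+ 2 + D.

(** The distance depends only on [t - s], and its square minus [(t - s) ^+ 2] is affine in [t - s];
    completing the square yields [a] and [D]. *)
Lemma flat_strip c c' : geodesic_line c -> geodesic_line c' -> parallel c c' ->
  exists a D, strip c c' a D.
Proof.
move=> lc lc' cc'; pose f b := mdist (c 0) (c' b).
have fE s t : mdist (c s) (c' t) = f (t - s).
  have pc := parallel_trans cc' (parallel_shift (t - s) lc').
  have := parallel_mdist s 0 lc (line_shift (t - s) lc') pc.
  by rewrite add0r [s + _]addrC subrK.
have f0 b : 0 <= f b := mdist_ge0 _ _.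
(* [h] is midpoint concave by the parallelogram inequality and midpoint convex
   by the CAT(0) inequality. *)
pose h b := f b ^+ 2 - b ^+ 2.
have hmid b u : h (b + u) + h (b - u) = 2 * h b.
  have := parallelogram_ineq catX (c 0) (c u) (c' (b + u)) (c' b).
  rewrite lc lc' !fE (metric_sym _ (c 0)) fE !subr0 sub0r normrN addrK.
  rewrite (_ : b + u - b = u); last by ring.
  rewrite real_normK ?num_real // => cvx.
  have k01 : 0 <= (2^-1 : R) <= 1 by lra.
  have bm : between 2^-1 (c' (b - u)) (c' (b + u)) (c' b).
    rewrite /between !lc'; have -> : b - u - b = - u by ring.
    have -> : b - u - (b + u) = - (2 * u) by ring.
    have -> : b - (b + u) = - u by ring.
    by rewrite !normrN normrM (ger0_norm (ler0n _ 2)); split; field.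
  have := cat0_between catX (c 0) k01 bm; rewrite !fE lc' !subr0.
  have -> : b - u - (b + u) = - (2 * u) by ring.
  rewrite normrN real_normK ?num_real // => ccv.
  by rewrite /h; apply/eqP; rewrite eq_le; apply/andP; split; lra.
have hb b : `|h b| <= f 0 ^+ 2 + 2 * f 0 * `|b|.
  have := mdist_quad (c 0) (c' b) (c 0) (c' 0).
  have := mdist_quad (c 0) (c' b) (c' 0) (c' b).
  rewrite !mdistxx add0r addr0 !lc' !fE !subr0 sub0r normrN.
  rewrite !ler_norml /h -[b ^+ 2](@real_normK _ b) ?num_real //.
  have := normr_ge0 b; have := f0 0; have := f0 b.
  move: (f b) (f 0) `|b| => x y z x0 y0 z0 /andP[H1 H2] /andP[H3 H4].
  by apply/andP; split; nra.
have hE := midpoint_affine hmid hb.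
(* The slope of [h] is [- 2 * a], so that [h b + b ^+ 2] is smallest at [b = a]. *)
pose a := - (h 1 - h 0) / 2; exists a, (f a ^+ 2); split; first exact: sqr_ge0.
move=> s t; rewrite fE.
have fh b : f b ^+ 2 = h b + b ^+ 2 by rewrite /h subrK.
by rewrite !fh (hE a) (hE (t - s)) /a; field.
Qed.

Lemma strip_reverse c c' a D : strip c c' a D ->
  strip (fun t => c (- t)) (fun t => c' (- t)) (- a) D.
Proof. by move=> [D0 cD]; split=> // s t; rewrite cD; ring. Qed.

Lemma strip_sym c c' a D : strip c c' a D -> strip c' c (- a) D.
Proof. by move=> [D0 cD]; split=> // s t; rewrite metric_sym cD; ring. Qed.

(** [sqrt (u^2 + D) <= u + D / u]: over a long stretch the width of the strip costs almost no extra
    length. *)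
Lemma strip_mdist_le c c' a D s t u : strip c c' a D -> 0 < u ->
  `|t - s - a| = u -> mdist (c s) (c' t) <= u + D / u.
Proof.
move=> [D0 cD] u0 stu.
have Du0 : 0 <= D / u by rewrite divr_ge0 // ltW.
rewrite -(@ler_pXn2r _ 2) ?nnegrE ?mdist_ge0 ?addr_ge0 ?(ltW u0) //.
rewrite cD -[(t - s - a) ^+ 2]real_normK ?num_real // stu sqrrD.
have -> : u * (D / u) = D by rewrite mulrC divfK // gt_eqF.
have := sqr_ge0 (D / u); lra.
Qed.

Lemma div_arbitrarily_small (D e : R) : 0 <= D -> 0 < e ->
  exists2 u0, 0 < u0 & forall u, u0 <= u -> D / u <= e.
Proof.
move=> D0 e0; exists (D / e + 1) => [|u uu0].
  by rewrite ltr_wpDl // divr_ge0 // ltW.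
have q0 : 0 <= D / e by rewrite divr_ge0 // ltW.
rewrite ler_pdivrMr; last lra.
by rewrite -ler_pdivrMl // mulrC; lra.
Qed.

(* Going once around the three strips at a very small slope costs almost
   nothing more than the distance travelled along the lines. *)
Lemma strip_cycle_le c1 c2 c3 a12 a23 a13 D12 D23 D13 : geodesic_line c1 ->
  strip c1 c2 a12 D12 -> strip c2 c3 a23 D23 -> strip c1 c3 a13 D13 ->
  a12 + a23 <= a13.
Proof.
move=> lc S12 S23 S13; apply/ler_addgt0Pl => e e0.
have e3 : 0 < e / 3 by rewrite divr_gt0.
have [u1 u10 H1] := div_arbitrarily_small S12.1 e3.
have [u2 u20 H2] := div_arbitrarily_small S23.1 e3.
have [u3 u30 H3] := div_arbitrarily_small S13.1 e3.
pose u := u1 + u2 + u3; have u0 : 0 < u by rewrite /u; lra.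
have {}H1 : D12 / u <= e / 3 by apply: H1; rewrite /u; lra.
have {}H2 : D23 / u <= e / 3 by apply: H2; rewrite /u; lra.
have {}H3 : D13 / u <= e / 3 by apply: H3; rewrite /u; lra.
(* Each leg advances by the shift of its strip plus [u]: the cycle ends on [c1] at parameter
   [a12 + a23 - a13 + 3 * u] and has length at most [3 * u + e]. *)
have L1 : mdist (c1 0) (c2 (a12 + u)) <= u + D12 / u.
  by apply: (strip_mdist_le S12 u0);
  rewrite -[RHS](gtr0_norm u0); congr `|_|; ring.
have L2 : mdist (c2 (a12 + u)) (c3 (a12 + a23 + 2 * u)) <= u + D23 / u.
  by apply: (strip_mdist_le S23 u0);
  rewrite -[RHS](gtr0_norm u0); congr `|_|; ring.
have L3 : mdist (c3 (a12 + a23 + 2 * u)) (c1 (a12 + a23 - a13 + 3 * u)) <=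
    u + D13 / u.
  apply: (strip_mdist_le (strip_sym S13) u0).
  by rewrite -[RHS](gtr0_norm u0); congr `|_|; ring.
have := metric_triangle (c1 0) (c2 (a12 + u)) (c1 (a12 + a23 - a13 + 3 * u)).
have := metric_triangle (c2 (a12 + u)) (c3 (a12 + a23 + 2 * u))
  (c1 (a12 + a23 - a13 + 3 * u)).
have : a12 + a23 - a13 + 3 * u <= mdist (c1 0) (c1 (a12 + a23 - a13 + 3 * u)).
  by rewrite lc sub0r normrN; exact: ler_norm.
lra.
Qed.

(** Reversing the three lines negates the shifts, which yields the other inequality. *)
Lemma strip_cycle c1 c2 c3 a12 a23 a13 D12 D23 D13 : geodesic_line c1 ->
  strip c1 c2 a12 D12 -> strip c2 c3 a23 D23 -> strip c1 c3 a13 D13 ->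
  a13 = a12 + a23.
Proof.
move=> lc S12 S23 S13; apply/eqP; rewrite eq_le (strip_cycle_le lc S12 S23 S13).
have := strip_cycle_le (line_reverse lc) (strip_reverse S12)
  (strip_reverse S23) (strip_reverse S13).
by rewrite -opprD lerN2 => ->.
Qed.

(** Convexity shows that the points at ratio [k] do not move too fast. If they moved too slowly, the
    path from [c1 (- T)] to [c1 T] through [m s] and [m t] would be shorter than the line; the shift
    [a] cancels between its two ends. *)
Lemma parallel_between c1 c2 (k : R) : geodesic_line c1 -> geodesic_line c2 ->
  parallel c1 c2 -> 0 <= k <= 1 ->
  exists c, geodesic_line c /\ forall s, between k (c1 s) (c2 s) (c s).
Proof.
move=> l1 l2 c12 k01; have [k0 k1] := andP k01.
have [m mE] := choice (fun s => between_exists catX (c1 s) (c2 s) k01).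
exists m; split=> // s t; apply/eqP; rewrite eq_le; apply/andP; split.
  by have := between_convex catX k01 (mE s) (mE t); rewrite l1 l2; lra.
have [a [D S]] := flat_strip l1 l2 c12.
wlog st : s t / s <= t => [wl|].
  have [/wl //|/ltW/wl] := leP s t.
  by rewrite distrC metric_sym.
rewrite distrC ger0_norm ?subr_ge0 //; apply/ler_addgt0Pl => e e0.
have e2 : 0 < e / 2 by rewrite divr_gt0.
have [u u0 H] := div_arbitrarily_small S.1 e2.
(* Large enough for both slanted paths below to advance by at least [u], so that each has excess at
   most [e / 2]. *)
pose T := `|s| + `|t| + `|a| + u.
have Ns := ler_norm s; have Nt := ler_norm t; have Na := ler_norm a.
have := ler_norm (- s); have := ler_norm (- t); have := ler_norm (- a).
rewrite !normrN => Na' Nt' Ns'.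
have u1 : u <= s + T - a by rewrite /T; lra.
have u2 : u <= T - t + a by rewrite /T; lra.
have sT : 0 <= T + s by rewrite /T; have := normr_ge0 t; have := normr_ge0 a; lra.
have tT : 0 <= T - t by rewrite /T; have := normr_ge0 s; have := normr_ge0 a; lra.
have D1 : mdist (c1 (- T)) (c2 s) <= s + T - a + e / 2.
  have p0 : 0 < s + T - a by lra.
  have pE : `|s - - T - a| = s + T - a by rewrite opprK gtr0_norm.
  by have := strip_mdist_le S p0 pE; have := H _ u1; lra.
have D2 : mdist (c1 T) (c2 t) <= T - t + a + e / 2.
  have p0 : 0 < T - t + a by lra.
  have pE : `|t - T - a| = T - t + a.
    by rewrite -normrN gtr0_norm; [ring|lra].
  by have := strip_mdist_le S p0 pE; have := H _ u2; lra.
have M1 := mdist_between_convex catX (c1 (- T)) k01 (mE s).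
have M2 := mdist_between_convex catX (c1 T) k01 (mE t).
have := metric_triangle (c1 (- T)) (m s) (c1 T).
have := metric_triangle (m s) (m t) (c1 T).
rewrite (metric_sym (m t) (c1 T)) !l1 in M1 M2 *.
rewrite (ler0_norm (_ : - T - T <= 0)); last lra.
rewrite (ler0_norm (_ : - T - s <= 0)) in M1; last lra.
rewrite (ger0_norm (_ : 0 <= T - t)) in M2; last lra.
have E1 : k * mdist (c1 (- T)) (c2 s) <= k * (s + T - a + e / 2).
  by rewrite ler_wpM2l.
have E2 : k * mdist (c1 T) (c2 t) <= k * (T - t + a + e / 2).
  by rewrite ler_wpM2l.
have ke : k * e <= e by rewrite ler_piMl // ltW.
lra.
Qed.

End Lines.

(** * Limits, parallel sets and product decompositions *)

Section Limits.
Context {R : realType} (X : metricType R).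
Implicit Types (x y z p : X) (c : R -> X).

Lemma cvg_mdist_near I (F : set_system I) (FF : Filter F) (f h : I -> X) p q e :
  f @ F --> p -> h @ F --> q -> 0 < e ->
  \forall i \near F, `|mdist (f i) (h i) - mdist p q| <= e.
Proof.
move=> fp hq e0; have e2 : 0 < e / 2 by rewrite divr_gt0.
near=> i; apply: le_trans (mdist_quad _ _ _ _) _.
rewrite (metric_sym (f i)) (metric_sym (h i)) (splitr e).
by apply: lerD; near: i;
  [exact: metricType_numDomainType.cvgr_dist_le fp _ e2
  |exact: metricType_numDomainType.cvgr_dist_le hq _ e2].
Unshelve. all: by end_near. Qed.

Lemma cvg_mdist_le I (F : set_system I) (FF : ProperFilter F) (f h : I -> X)
    p q M : f @ F --> p -> h @ F --> q ->
  (\forall i \near F, mdist (f i) (h i) <= M) -> mdist p q <= M.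
Proof.
move=> fp hq fM; apply/ler_addgt0Pl => e e0.
have [i [iM]] := filter_ex (filterI fM (cvg_mdist_near FF fp hq e0)).
by rewrite ler_norml /= in iM *; lra.
Qed.

Lemma cvg_mdist_eq I (F : set_system I) (FF : ProperFilter F) (f h : I -> X)
    p q M : f @ F --> p -> h @ F --> q ->
  (\forall i \near F, mdist (f i) (h i) = M) -> mdist p q = M.
Proof.
move=> fp hq fM; apply/eqP; rewrite eq_le; apply/andP; split.
  by apply: cvg_mdist_le fp hq _; apply: filterS fM => i ->.
apply/ler_addgt0Pl => e e0.
have [i [<-]] := filter_ex (filterI fM (cvg_mdist_near FF fp hq e0)).
by rewrite ler_norml /=; lra.
Qed.

Hypothesis properX : proper_space X.

Lemma ultra_limit I (U : set_system I) (f : I -> X) x (M : R) :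
  UltraFilter U -> (\forall i \near U, mdist x (f i) <= M) ->
  exists p, f @ U --> p.
Proof.
move=> UU fM; have [p [_ clp]] := properX (fmap_proper_filter f _) fM.
exists p => V Vp; have [//|UV] := in_ultra_setVsetC (f @^-1` V) UU.
by have [q []] := clp (~` V) V UV Vp.
Qed.

(** One ultrafilter serves all parameters at once, with no diagonal extraction. The isometry
    condition is only eventual for each pair, so the [c i] may be rays whose origins recede. *)
Lemma ultra_limit_line I (U : set_system I) (c : I -> R -> X) x (M : R) :
  UltraFilter U -> (\forall i \near U, mdist x (c i 0) <= M) ->
  (forall s t, \forall i \near U, mdist (c i s) (c i t) = `|s - t|) ->
  exists2 c', geodesic_line c' & forall s, (fun i => c i s) @ U --> c' s.
Proof.
move=> UU cM cE.
have cvg s : exists p, (fun i => c i s) @ U --> p.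
  apply: (@ultra_limit _ U _ x (M + `|s|) UU).
  apply: filterS2 cM (cE 0 s) => i iM iE.
  apply: le_trans (metric_triangle _ (c i 0) _) _.
  by rewrite iE sub0r normrN lerD2r.
have [c' cc'] := choice cvg; exists c' => // s t.
exact: cvg_mdist_eq (cc' s) (cc' t) (cE s t).
Qed.

End Limits.

(** * Closedness and convexity of the union of the parallels to a line *)

Section ParallelSet.
Context {R : realType} (X : metricType R).
Hypotheses (properX : proper_space X) (catX : CAT0 X).
Implicit Types (x y z p : X) (c : R -> X).

(** Normalizing [c' 0 = x] loses nothing, since a shift of a parallel line is again parallel. *)
Definition parallel_set c : set X :=
  [set x | exists c', [/\ geodesic_line c', parallel c c' & c' 0 = x]].

(** Lines through points tending to [x] converge along an ultrafilter. Their distance to a fixed one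
    of them is constant in the parameter, hence bounded by its value at the origin, and the bound
    passes to the limit. *)
Lemma parallel_set_closed c : geodesic_line c -> closed (parallel_set c).
Proof.
move=> lc x clx.
have PF : ProperFilter (within (parallel_set c) (nbhs x)).
  exact: within_nbhs_proper.
have [U [UU sU]] := ultraFilterLemma PF.
have Ux V : nbhs x V -> U V by move=> Vx; apply: sU; apply: filterS Vx => z.
have UP : U (parallel_set c) by apply: sU; exact: withinT.
have /choice[l lE] : forall z, exists c', parallel_set c z ->
    [/\ geodesic_line c', parallel c c' & c' 0 = z].
  move=> z; have [[c' c'P]|nP] := pselect (parallel_set c z); first by exists c'.
  by exists c.
have Ub : \forall z \near U, mdist x z <= 1.
  apply: Ux; apply/metricType_numDomainType.nbhs_mdistP.
  by exists 1 => //= z; exact: ltW.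
have [c' lc' cc'] : exists2 c', geodesic_line c' &
    forall s, (fun z => l z s) @ U --> c' s.
  apply: (@ultra_limit_line _ _ properX _ U l x 1 UU).
    by apply: filterS2 UP Ub => z /lE[_ _ ->].
  by move=> s t; apply: filterS UP => z /lE[-> _ _].
have id_cvg : id @ U --> x by move=> V /Ux.
exists c'; split => //.
  have [z0 [/lE[l0 c0 z00] z01]] := filter_ex (filterI UP Ub).
  apply: (parallel_trans c0); exists (1 + 1) => t.
  have cst : (fun=> l z0 t) @ U --> l z0 t by exact: cvg_cst.
  apply: cvg_mdist_le cst (cc' t) _.
  apply: filterS2 UP Ub => z /lE[lz cz zz] z1.
  rewrite (@parallel_mdist _ _ catX _ _ t 0) //; last first.
    exact: parallel_trans (parallel_sym c0) cz.
  rewrite z00 zz; apply: le_trans (metric_triangle _ x _) _.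
  by apply: lerD => //; rewrite metric_sym.
apply: mdist_positivity; apply: cvg_mdist_eq (cc' 0) id_cvg _.
by apply: filterS UP => z /lE[_ _ ->]; rewrite mdistxx.
Unshelve. all: by end_near. Qed.

Lemma parallel_set_convex c : geodesic_line c ->
  geodesically_convex (parallel_set c).
Proof.
move=> lc x y g [cx [lx px x0]] [cy [ly py y0]] gg t.
rewrite in_itv /= => /andP[t0 t1].
have [xy0|xyn0] := eqVneq (mdist x y) 0.
  have -> : t = 0 by apply/eqP; rewrite eq_le t0 -xy0 t1.
  by have [-> _ _] := gg; exists cx.
have xy0 : 0 < mdist x y by rewrite lt_neqAle eq_sym xyn0 mdist_ge0.
have k01 : 0 <= t / mdist x y <= 1.
  by rewrite divr_ge0 ?mdist_ge0 //= ler_pdivrMr // mul1r.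
have pxy := parallel_trans (parallel_sym px) py.
have [m [lm mE]] := parallel_between catX lx ly pxy k01.
exists m; split=> //.
  apply: (parallel_trans px); exists (mdist x y) => s.
  have [-> _] := mE s; rewrite (parallel_mdist catX s 0 lx ly pxy) x0 y0.
  by rewrite ler_piMl ?mdist_ge0 //; case/andP: k01.
have := geodesic_between k01 gg; rewrite divfK //.
by apply: (between_uniq catX k01); have := mE 0; rewrite x0 y0.
Qed.

End ParallelSet.

Section Subspace.
Context {R : realType} (X : metricType R) (A : set X).

Definition subspace_type := {x : X | x \in A}.

HB.instance Definition _ := Choice.on subspace_type.

Let dist (x y : subspace_type) : R := mdist (val x) (val y).

Let dist_xx x : dist x x = 0.
Proof. exact: mdistxx. Qed.

Let dist_positivity x y : dist x y = 0 -> x = y.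
Proof. by move=> /mdist_positivity /val_inj. Qed.

Let dist_sym x y : dist x y = dist y x.
Proof. exact: metric_sym. Qed.

Let dist_triangle y x z : dist x z <= dist x y + dist y z.
Proof. exact: metric_triangle. Qed.

HB.instance Definition _ := isMetric.Build R subspace_type
  dist_xx dist_positivity dist_sym dist_triangle.

End Subspace.

(** * Splitting off a line, and a bound on the dimension of Euclidean factors *)

Section Splitting.
Context {R : realType} (X : metricType R).
Hypothesis catX : CAT0 X.
Implicit Type c : R -> X.

(* The points projecting to [c 0] on [c]. *)
Definition cross_section c : set X := [set x | exists l,
  [/\ geodesic_line l, parallel c l, l 0 = x & exists D, strip c l 0 D]].

Lemma euclidean_dist1 (v w : 'rV[R]_1) : euclidean_dist v w = `|v 0 0 - w 0 0|.
Proof. by rewrite /euclidean_dist big_ord_recl big_ord0 addr0 sqrtr_sqr. Qed.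

(** A point is located by its parallel, which meets the cross-section once, and its parameter there.
    By [strip_cycle], two parallels without shift relative to [c] have none relative to each other,
    so the strip formula becomes Pythagoras' theorem. *)
Lemma parallel_set_splitting c : geodesic_line c ->
  parallel_set c = [set: X] ->
  exists (Y : metricType R) (phi : 'rV[R]_1 -> Y -> X),
    euclidean_splitting phi /\ exists y : Y, forall t, c t = phi (const_mx t) y.
Proof.
move=> lc cT; pose Y := subspace_type (cross_section c).
have /choice[l lE] : forall y : Y, exists l, [/\ geodesic_line l,
    parallel c l, l 0 = val y & exists D, strip c l 0 D].
  by move=> y; exact: set_mem (valP y).
have uniq x0 l' t (x0P : x0 \in cross_section c) : geodesic_line l' ->
    parallel c l' -> l' 0 = x0 -> l (exist _ x0 x0P) t = l' t.
  move=> ll' pl' l'0; have [ly py y0 _] := lE (exist _ x0 x0P).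
  apply: (parallel_mdist0 catX t ly ll'); last by rewrite y0 l'0.
  exact: parallel_trans (parallel_sym py) pl'.
exists Y, (fun v y => l y (v 0 0)); split; last first.
  have c0 : c 0 \in cross_section c.
    apply/mem_set; exists c; split=> //; first exact: parallel_refl.
    exists 0; split=> // s t.
    by rewrite lc real_normK ?num_real // subr0 addr0 -sqrrN opprB.
  exists (exist _ (c 0) c0) => t; rewrite mxE (uniq _ c) //.
  exact: parallel_refl.
split=> [v w y z|x].
  have [ly py y0 [Dy Sy]] := lE y; have [lz pz z0 [Dz Sz]] := lE z.
  have pyz := parallel_trans (parallel_sym py) pz.
  have [a [D S]] := flat_strip catX ly lz pyz.
  have := strip_cycle lc Sy S Sz; rewrite add0r => a0; subst a.
  have DE : mdist y z ^+ 2 = D.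
    by rewrite [mdist y z]/(mdist (val y) (val z)) -y0 -z0 S.2; ring.
  rewrite euclidean_dist1 real_normK ?num_real // DE.
  rewrite -[LHS](ger0_norm (mdist_ge0 _ _)) -sqrtr_sqr S.2; congr Num.sqrt; ring.
have : parallel_set c x by rewrite cT.
move=> [l' [ll' pl' l'0]]; have [a [D S]] := flat_strip catX lc ll' pl'.
(* Shift the line so that its origin is opposite to [c 0]: the new origin lies in the cross-section,
   and [x] has coordinate [- a]. *)
have la := line_shift a ll'.
have pa := parallel_trans pl' (parallel_shift a ll').
have xP : l' a \in cross_section c.
  apply/mem_set; exists (fun t => l' (t + a)); split=> //; first by rewrite add0r.
  by exists D; split; [exact: S.1|move=> s t; rewrite S.2; ring].
exists (const_mx (- a)), (exist _ (l' a) xP); rewrite mxE.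
by rewrite (uniq _ _ (- a) xP la pa) ?addNr // add0r.
Qed.

Lemma splitting_add n (Y Z : metricType R) (phi : 'rV[R]_n -> Y -> X)
    (psi : 'rV[R]_1 -> Z -> Y) :
  euclidean_splitting phi -> euclidean_splitting psi ->
  euclidean_splitting (fun (v : 'rV[R]_(n + 1)) z =>
    phi (lsubmx v) (psi (rsubmx v) z)).
Proof.
move=> [phid phis] [psid psis]; split=> [v w y z|x].
  rewrite phid psid; congr Num.sqrt.
  have sum0 m (a b : 'rV[R]_m) : 0 <= \sum_(i < m) (a 0 i - b 0 i) ^+ 2.
    by apply: sumr_ge0 => i _; exact: sqr_ge0.
  rewrite (sqr_sqrtr (addr_ge0 (sqr_ge0 _) (sqr_ge0 _))) addrA; congr (_ + _).
  rewrite /euclidean_dist !sqr_sqrtr // big_split_ord /=.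
  by congr (_ + _); apply: eq_bigr => i _; rewrite !mxE.
have [v [y <-]] := phis x; have [w [z <-]] := psis y.
by exists (row_mx v w), z; rewrite row_mxKl row_mxKr.
Qed.

(** Compactness as near covering, along the filter of finite sets ordered by inclusion: near a point
    [x], every finite set containing [x] works. *)
Lemma compact_finite_net (K : set X) (e : R) : compact K -> 0 < e ->
  exists D : {fset X}, forall x, K x -> exists2 z, z \in D & mdist z x < e.
Proof.
move=> cK e0.
pose F := filter_from [set: {fset X}] (fun D => [set D' | (D `<=` D')%fset]).
have FF : Filter F.
  apply: filter_from_filter; first by exists fset0.
  move=> D1 D2 _ _; exists (D1 `|` D2)%fset => // D /= D12.
  by split; apply: fsubset_trans D12; [exact: fsubsetUl|exact: fsubsetUr].
have := (compact_near_coveringP K).1 cK _ F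
  (fun D x => exists2 z, z \in D & mdist z x < e) FF.
case=> [x Kx|D _ DK]; last by exists D; exact: DK (fsubset_refl D).
exists ([set y | mdist x y < e], [set D : {fset X} | x \in D]) => /=.
  split; first by apply/metricType_numDomainType.nbhs_mdistP; exists e.
  by exists [fset x]%fset => // D /=; rewrite fsub1set.
by move=> [y D] /= [xy xD]; exists x.
Qed.

(** The [n] coordinate vectors give points of the unit ball around [x] at mutual distance at least
    1, so a finite net of mesh one half has at least [n] elements. *)
Lemma splitting_bound (x : X) : proper_space X ->
  exists N, forall n (Y : metricType R) (phi : 'rV[R]_n -> Y -> X),
    euclidean_splitting phi -> (n <= N)%N.
Proof.
move=> properX; have e0 : 0 < 2^-1 :> R by rewrite invr_gt0.
have [D xD] := compact_finite_net (properX x 1) e0.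
exists #|{: D}| => n Y phi [phid phis].
have [v [y vyx]] := phis x.
pose e (i : 'I_n) := phi (v + delta_mx 0 i) y.
have delta_sum (i : 'I_n) : \sum_(k < n) (delta_mx 0 i : 'rV[R]_n) 0 k ^+ 2 = 1.
  rewrite (bigD1 i) //= mxE !eqxx big1 ?expr1n ?addr0 // => k ki.
  by rewrite mxE (negPf ki) expr0n.
have ex i : mdist x (e i) <= 1.
  rewrite -vyx /e phid mdistxx expr0n addr0 sqrtr_sqr ger0_norm ?sqrtr_ge0 //.
  rewrite /euclidean_dist (_ : \sum_(_ < _) _ = 1) ?sqrtr1 // -(delta_sum i).
  apply: eq_bigr => k _; rewrite [(v + _) 0 k]mxE opprD addrA subrr sub0r.
  by rewrite sqrrN.
have eij i j : i != j -> 1 <= mdist (e i) (e j).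
  move=> ij; rewrite /e phid mdistxx expr0n addr0 sqrtr_sqr ger0_norm ?sqrtr_ge0 //.
  rewrite -[X in X <= _]sqrtr1 ler_wsqrtr // (bigD1 i) //= !mxE !eqxx (negPf ij).
  rewrite addr0 addrAC subrr add0r expr1n lerDl.
  by apply: sumr_ge0 => k _; exact: sqr_ge0.
have /choice[g gE] : forall i, exists z : D, mdist (val z) (e i) < 2^-1.
  move=> i; have [z Dz ze] := xD _ (ex i).
  by exists (FSetSub Dz).
rewrite -[n]card_ord; apply: (leq_card g) => i j gij.
apply/eqP/negPn/negP => /eij; apply/negP; rewrite -ltNge.
have := gE i; have := gE j; rewrite gij => j2 i2.
apply: le_lt_trans (metric_triangle _ (val (g j)) _) _.
by rewrite (metric_sym (e i)); lra.
Qed.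

End Splitting.

(** * The displacement sets of a closed group of isometries *)

Section Action.
Context {R : realType} (X : metricType R) (G : groupClosed (Isom X)).
Implicit Types (x y z p q : X) (g h k : subgroup G).

Lemma actM g h x : val (g * h)%g x = val g (val h x).
Proof. by rewrite gmulfM. Qed.

Lemma actV g : cancel (val g) (val g^-1%g).
Proof. by move=> x; rewrite -actM mulVg gmulf1. Qed.

Lemma actKV g : cancel (val g^-1%g) (val g).
Proof. by move=> x; rewrite -actM mulgV gmulf1. Qed.

Lemma actE g : (val g : Isom X) \in G.
Proof. exact: valP. Qed.

Lemma open_mdist_lt y (e : R) : open [set z | mdist z y < e].
Proof.
rewrite openE => z /= zy; apply/metricType_numDomainType.nbhs_mdistP.
exists (e - mdist z y) => /=; first by rewrite subr_gt0.
by move=> t /= zt; have := metric_triangle t z y; rewrite (metric_sym t z); lra.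
Qed.

Lemma open_mdist_gt y (e : R) : open [set z | e < mdist z y].
Proof.
rewrite openE => z /= zy; apply/metricType_numDomainType.nbhs_mdistP.
exists (mdist z y - e) => /=; first by rewrite subr_gt0.
by move=> t /= zt; have := metric_triangle z t y; lra.
Qed.

Lemma open_act x (O : set X) : open O -> open [set g : subgroup G | O (val g x)].
Proof.
move=> oO; exists [set f : Isom X | O (f x)] => //.
exists [set f : {compact-open, X -> X} | f @` [set x] `<=` O].
  exact: compact_open_open (@compact_set1 _ x) oO.
by apply/seteqP; split=> f /= fO; [apply: fO; exists x|move=> _ [_ -> <-]].
Qed.

(** Two base points are kept because left translations move [y] and right translations move [x]; the
    displacement sets are the case [x = y]. *)
Definition transporter x y (e : R) : set (subgroup G) :=
  [set g : subgroup G | mdist (val g x) y <= e].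

Lemma closed_transporter x y e : closed (transporter x y e).
Proof.
rewrite -openC (_ : ~` _ = [set g : subgroup G | [set z | e < mdist z y] (val g x)]).
  exact/open_act/open_mdist_gt.
by apply/seteqP; split=> g /=; rewrite ltNge => /negP.
Qed.

Lemma initial_cvg (S : choiceType) (T : topologicalType) (f : S -> T)
    (F : set_system S) (s : S) : Filter F ->
  f @ F --> f s -> F --> (s : initial_topology f).
Proof.
move=> FF fF A /= [_ [[B oB <-] Bs sBA]].
by apply: filterS sBA _; apply: fF; exact: open_nbhs_nbhs.
Qed.

(* For isometries pointwise convergence is uniform on compact sets. *)
Lemma isometry_compact_open_cvg I (F : set_system I) (f : I -> Isom X)
    (f0 : Isom X) : Filter F ->
  (forall x, (fun i => f i x) @ F --> f0 x) -> f @ F --> f0.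
Proof.
move=> FF ff0; apply: initial_cvg.
have FF' : Filter ((fun i => isometry_fun (f i)) @ F) by exact: fmap_filter.
apply: (@compact_open_cvgP X X _ _ _).2 => K O cK oO f0K.
suff : \forall i \near F, K `<=` (fun x => O (f i x)).
  by apply: filterS => i iK _ [x Kx <-]; exact: iK.
apply: ((compact_near_coveringP K).1 cK _ F (fun i x => O (f i x)) FF) => x Kx.
have : nbhs (f0 x) O by apply: open_nbhs_nbhs; split=> //; apply: f0K; exists x.
move=> /metricType_numDomainType.nbhs_mdistP[e /= e0 eO].
have e2 : 0 < e / 2 by rewrite divr_gt0.
have := metricType_numDomainType.cvgr_dist_lt (ff0 x) e2 => xe.
exists ([set y | mdist x y < e / 2],
        [set i | mdist (f0 x) (f i x) < e / 2]) => /=.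
  split; last exact: xe.
  by apply/metricType_numDomainType.nbhs_mdistP; exists (e / 2).
move=> [y i] /= [xy fi]; apply: eO => /=.
have := metric_triangle (f0 x) (f i x) (f i y).
rewrite isometry_mdist; lra.
Qed.

Lemma act_continuous x : continuous (fun g : subgroup G => val g x).
Proof. by apply/continuousP => O; exact: open_act. Qed.

Lemma subgroup_hausdorff : hausdorff_space (subgroup G).
Proof.
move=> g h gh; apply/val_inj/isometry_eqP => x; apply: metric_hausdorff.
move=> A B /(@act_continuous x g) gA /(@act_continuous x h) hB.
by have [k [kA kB]] := gh _ _ gA hB; exists (val k x).
Qed.

Hypotheses (properX : proper_space X) (closedG : closed [set` G]).

(** The Arzela-Ascoli theorem by ultrafilters: these elements keep the image of each point in a
    ball, hence converge pointwise, and the limit is in [G] by closedness. *)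
Lemma compact_transporter x y e : compact (transporter x y e).
Proof.
rewrite compact_ultra => F FU Fxy.
have /choice[h hE] z : exists p, (fun g => val g z) @ F --> p.
  apply: (@ultra_limit _ _ properX _ F _ y (e + mdist x z)).
  apply: filterS Fxy => g /= gxy.
  apply: le_trans (metric_triangle _ (val g x) _) _.
  by rewrite isometry_mdist metric_sym lerD2r.
(* Limits of the inverses are taken too, to make the limit isometry bijective. *)
have /choice[h' h'E] z : exists p, (fun g => val g^-1%g z) @ F --> p.
  apply: (@ultra_limit _ _ properX _ F _ x (e + mdist y z)).
  apply: filterS Fxy => g /= gxy; rewrite -(isometry_mdist (val g)) actKV.
  by apply: le_trans (metric_triangle _ y _) _; rewrite lerD2r.
have hd p q : mdist (h p) (h q) = mdist p q.
  by apply: cvg_mdist_eq (hE p) (hE q) _; apply: nearW => g; exact: isometry_mdist.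
have h'K z : h (h' z) = z.
  apply: mdist_positivity; apply/eqP; rewrite eq_le mdist_ge0 andbT.
  apply/ler_addgt0Pl => r r0; rewrite addr0.
  have cst : (fun=> z) @ F --> z by exact: cvg_cst.
  apply: cvg_mdist_le (hE (h' z)) cst _.
  apply: filterS (metricType_numDomainType.cvgr_dist_le (h'E z) r0) => g.
  by rewrite -(isometry_mdist (val g)) actKV.
have hK : cancel h h'.
  move=> z; apply: mdist_positivity; rewrite -hd h'K; exact: mdistxx.
pose f := Isometry hd (Bijective hK h'K).
have Ff : (val : subgroup G -> Isom X) @ F --> f.
  exact: isometry_compact_open_cvg.
have Gf : f \in G.
  suff : [set` G] f by [].
  apply: (closed_cvg _ closedG _ _ Ff).
  by apply: nearW => g; exact: actE.
have FG : F --> (exist _ f Gf : subgroup G) by exact: initial_cvg.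
exists (exist _ f Gf); split=> //.
exact: (closed_cvg _ (@closed_transporter x y e) Fxy _ FG).
Qed.

End Action.

(** * Haar measure of displacement sets *)

Section Haar.
Context {R : realType} (X : metricType R) (G : groupClosed (Isom X)).
Hypotheses (properX : proper_space X) (closedG : closed [set` G]).
Variable mu :
  {measure set (g_sigma_algebraType (@open (subgroup G))) -> \bar R}.
Hypotheses (haar_mu : left_haar_measure mu) (mu_right : right_invariant mu).
Implicit Types (x y z p q : X) (g h k : subgroup G).

Let T := subgroup G.
Local Notation measurable := ((@open T).-sigma.-measurable).

Lemma measurable_open (A : set T) : open A -> measurable A.
Proof. exact: sub_sigma_algebra. Qed.

Lemma measurable_closed (A : set T) : closed A -> measurable A.
Proof.
by move=> cA; rewrite -[A]setCK; apply: measurableC; apply: measurable_open;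
  exact: closed_openC.
Qed.

Lemma measurable_transporter x y e : measurable (transporter (G := G) x y e).
Proof. by apply: measurable_closed; exact: closed_transporter. Qed.

Lemma transporter_left k x y e :
  [set (k * h)%g | h in transporter x y e] = transporter x (val k y) e.
Proof.
apply/seteqP; split=> [_ [h xy <-]|g xy].
  by rewrite /transporter /mkset actM isometry_mdist.
exists (k^-1 * g)%g; last by rewrite mulVKg.
by rewrite /transporter /mkset actM -(isometry_mdist (val k)) actKV.
Qed.

Lemma transporter_right k x y e :
  [set (h * k)%g | h in transporter (val k x) y e] = transporter x y e.
Proof.
apply/seteqP; split=> [_ [h xy <-]|g xy].
  by rewrite /transporter /mkset actM.
exists (g * k^-1)%g; last by rewrite mulgVK.
by rewrite /transporter /mkset actM actV.
Qed.

Definition volume x (e : R) : R := fine (mu (transporter x x e)).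

Lemma transporter_fin_num x y e : mu (transporter x y e) \is a fin_num.
Proof.
rewrite ge0_fin_numE ?measure_ge0 //; have [[H _ _] _ _] := haar_mu.
by apply: H; exact: compact_transporter.
Qed.

(** A right translation by [k] replaces the first base point, a left translation by its inverse the
    second: both invariances of [mu] enter here. *)
Lemma volume_act k x e : volume (val k x) e = volume x e.
Proof.
have [_ _ mu_left] := haar_mu.
rewrite /volume -(mu_right k); last exact: measurable_transporter.
rewrite transporter_right -(mu_left k^-1%g); last exact: measurable_transporter.
by rewrite transporter_left actV.
Qed.

Lemma volume_le x y e e' : transporter (G := G) x x e `<=` transporter y y e' ->
  volume x e <= volume y e'.
Proof.
move=> xy; apply: fine_le; rewrite ?transporter_fin_num //.
by apply: le_measure => //; apply/mem_set; exact: measurable_transporter.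
Qed.

Lemma volume_near x y e (d : R) : mdist x y <= d ->
  volume x e <= volume y (e + 2 * d).
Proof.
move=> xy; apply: volume_le => g; rewrite /transporter /= => gx.
have := metric_triangle (val g y) (val g x) y.
have := metric_triangle (val g x) x y.
by rewrite isometry_mdist (metric_sym y x); lra.
Qed.

(** The strict bounds make this set open; it will measure the gap between two displacement sets. *)
Definition moves x p y q (a b : R) : set T :=
  [set g : T | mdist (val g x) p < a /\ b < mdist (val g y) q].

Lemma open_moves x p y q a b : open (moves x p y q a b).
Proof.
apply: openI; first exact: open_act (open_mdist_lt p a).
exact: open_act (open_mdist_gt q b).
Qed.

Lemma moves_left k x p y q a b :
  [set (k * h)%g | h in moves x p y q a b] = moves x (val k p) y (val k q) a b.
Proof.
apply/seteqP; split=> [_ [h xy <-]|g xy].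
  by rewrite /moves /mkset !actM !isometry_mdist.
exists (k^-1 * g)%g; last by rewrite mulVKg.
have kE u v : mdist (val k^-1%g u) v = mdist u (val k v).
  by rewrite -(isometry_mdist (val k)) actKV.
by rewrite /moves /mkset !actM !kE.
Qed.

(** If the set were null, finitely many of its left translates would cover any given compact set,
    and inner regularity would make [mu] zero. *)
Lemma haar_moves_gt0 x p y q a b : moves x p y q a b !=set0 ->
  (0 < mu (moves x p y q a b))%E.
Proof.
move=> [g0 g0P]; have [[_ _ mu_inner] muT mu_left] := haar_mu.
rewrite lt0e measure_ge0 andbT; apply/eqP => mu0.
apply: muT; rewrite mu_inner; last exact: openT.
(* The left translate by [k * g0^-1], which contains [k]. *)
pose W (k : T) := moves x (val (k * g0^-1)%g p) y (val (k * g0^-1)%g q) a b.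
have muW k : mu (W k) = 0%E.
  by rewrite /W -moves_left mu_left //; apply: measurable_open; exact: open_moves.
suff muK (K : set T) : compact K -> mu K = 0%E.
  apply/eqP; rewrite eq_le; apply/andP; split.
    by apply: ge_ereal_sup => _ [K [cK _] <-]; rewrite muK.
  apply: ereal_sup_ubound; exists set0; last exact: measure0.
  by split; first exact: compact0.
move=> cK; move: (cK); rewrite compact_cover => /(_ T setT W)[] //.
- by move=> k _; exact: open_moves.
- move=> k _; exists k => //; rewrite /W -moves_left; exists g0 => //.
  by rewrite mulgVK.
move=> D _ KD; apply/eqP; rewrite -measure_le0.
have mK : measurable K.
  apply: measurable_closed; apply: compact_closed => //.
  exact: subgroup_hausdorff.
have mW k : [set` D] k -> measurable (W k).
  by move=> _; apply: measurable_open; exact: open_moves.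
apply: le_trans (content_sub_fsum mu (finite_fset D) mW mK KD) _.
rewrite fsbig1 // => k _; exact: muW.
Qed.

End Haar.

(** * Volume along a ray towards a fixed point *)

(** Cutting the interval into [n] pieces would force an increase of at least [n * w] between [a] and
    [b], for every [n]. *)
Lemma no_uniform_jump (R : realType) (f : R -> R) (a b w : R) :
  a < b -> 0 < w ->
  ~ (forall u v, a <= u -> u < v -> v <= b -> f u + w <= f v).
Proof.
move=> ab w0 jump.
have fab : 0 <= f b - f a by have := jump a b (lexx _) ab (lexx _); lra.
pose n := (Num.truncn ((f b - f a) / w)).+1.
have nw : f b - f a < n%:R * w.
  rewrite -ltr_pdivrMr //.
  by have /andP[] := truncn_itv (divr_ge0 fab (ltW w0)).
pose h := (b - a) / n%:R.
have n0 : 0 < n%:R :> R by rewrite ltr0n.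
have h0 : 0 < h by rewrite divr_gt0 // subr_gt0.
have hn : a + n%:R * h = b by rewrite /h mulrC divfK ?gt_eqF //; ring.
have step i : (i <= n)%N -> f a + i%:R * w <= f (a + i%:R * h).
  elim: i => [_|i IH lin]; first by rewrite !mul0r !addr0.
  have i0 : 0 <= i%:R * h by rewrite mulr_ge0 // ltW.
  have iE : a + i.+1%:R * h = a + i%:R * h + h by rewrite -natr1; ring.
  have ib : a + i.+1%:R * h <= b.
    by rewrite -hn lerD2l ler_pM2r // ler_nat.
  have := jump (a + i%:R * h) (a + i.+1%:R * h).
  have ai : a <= a + i%:R * h by lra.
  rewrite iE ltrDl h0 -iE => /(_ ai isT ib) H.
  have wE : i.+1%:R * w = i%:R * w + w by rewrite -natr1; ring.
  by have := IH (ltnW lin); rewrite wE; lra.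
by have := step n (leqnn _); rewrite hn; lra.
Qed.

Section LimitLine.
Context {R : realType} (X : metricType R) (G : groupClosed (Isom X)).
Hypotheses (properX : proper_space X) (catX : CAT0 X).
Hypothesis closedG : closed [set` G].
Variable mu :
  {measure set (g_sigma_algebraType (@open (subgroup G))) -> \bar R}.
Hypotheses (haar_mu : left_haar_measure mu) (mu_right : right_invariant mu).
Variables (r c : R -> X).
Hypothesis ray_r : geodesic_ray r.
Hypothesis fix_r : forall g : subgroup G, asymptotic (val g \o r) r.

Lemma volume_ray_le s t e : 0 <= s -> s <= t ->
  volume mu (r s) e <= volume mu (r t) e.
Proof.
move=> s0 st; apply: (volume_le properX closedG haar_mu) => g.
rewrite /transporter /mkset; apply: le_trans.
have gr : geodesic_ray (val g \o r).
  by move=> u v u0 v0 /=; rewrite isometry_mdist; exact: ray_r.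
exact: (asymptotic_nonincreasing catX gr ray_r (fix_r g) s0 st).
Qed.

(** The elements of [moves] displace [y] by less than [a <= e] but [x] by more than [b >= e], so
    they lie in the larger displacement set and outside the smaller one. *)
Lemma volume_gap x y (e a b : R) :
  transporter (G := G) x x e `<=` transporter y y e -> a <= e -> e <= b ->
  volume mu x e + fine (mu (moves (G := G) y y x x a b)) <= volume mu y e.
Proof.
move=> xy ae eb; have [mx my] := (measurable_transporter (G := G) x x e,
  measurable_transporter (G := G) y y e).
have mW : ((@open (subgroup G)).-sigma.-measurable) (moves (G := G) y y x x a b).
  by apply: measurable_open; exact: open_moves.
have Wy : moves (G := G) y y x x a b `<=` transporter y y e.
  by move=> g [ya _]; rewrite /transporter /mkset; lra.
have fy := transporter_fin_num properX closedG haar_mu y y e.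
have fx := transporter_fin_num properX closedG haar_mu x x e.
have fW : mu (moves (G := G) y y x x a b) \is a fin_num.
  rewrite ge0_fin_numE ?measure_ge0 //.
  apply: (@le_lt_trans _ _ (mu (transporter y y e))).
    by apply: le_measure => //; apply/mem_set.
  by rewrite -ge0_fin_numE ?measure_ge0.
rewrite /volume -fineD // fine_le ?fin_numD ?fx //.
rewrite -measureU //; last first.
  apply/seteqP; split=> // g [gx [_ bx]].
  by move: gx; rewrite /transporter /mkset; lra.
apply: le_measure; [apply/mem_set|exact/mem_set|].
  exact: measurableU.
by rewrite subUset.
Qed.

Hypothesis limit_c : forall s N e : R, 0 <= N -> 0 < e ->
  exists (k : subgroup G) (t : R), N <= t /\ mdist (val k (r t)) (c s) <= e.
Hypothesis bounded_r : exists (x0 : X) (D : R), forall t : R, 0 <= t ->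
  exists k : subgroup G, mdist (val k (r t)) x0 <= D.
Hypothesis nonincr_c : forall (g : subgroup G) (s t : R), s <= t ->
  mdist (val g (c t)) (c t) <= mdist (val g (c s)) (c s).

(* By unimodularity the volume function is [G]-invariant, hence bounded along
   [r]; it increases along [r] to a limit which, up to an arbitrarily small
   change of radius, is its value at every point of the limit line [c]. *)
Lemma limit_line_displacement (g : subgroup G) (s t : R) :
  mdist (val g (c s)) (c s) = mdist (val g (c t)) (c t).
Proof.
wlog st : s t / s <= t => [wl|].
  by have [/wl //|/ltW/wl] := leP s t.
apply/eqP; rewrite eq_le (nonincr_c g st) andbT leNgt; apply/negP => lt.
pose V e := [set volume mu (r u) e | u in [set u | 0 <= u]].
have V0 e : V e !=set0 by exists (volume mu (r 0) e), 0 => /=.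
have Vub e : has_ubound (V e).
  have [x0 [D xD]] := bounded_r.
  exists (volume mu x0 (e + 2 * D)) => _ [u /= u0 <-].
  have [k kD] := xD u u0.
  by rewrite -(volume_act haar_mu mu_right k); exact: volume_near.
have Vsup e : has_sup (V e) by [].
pose M e := sup (V e).
(* Some translate of a point [r v], with [v] as large as desired, lies within [d] of [c u];
   exchanging these two points enlarges the radius by [2 * d]. *)
have upper u (e d : R) : 0 < d -> volume mu (c u) e <= M (e + 2 * d).
  move=> d0; have [k [v [v0 kv]]] := limit_c u (lexx 0) d0.
  have kv' : mdist (c u) (val k (r v)) <= d by rewrite metric_sym.
  apply: le_trans (volume_near properX closedG haar_mu e kv') _.
  by rewrite (volume_act haar_mu mu_right); apply: ub_le_sup => //; exists v.
have lower u (e d w : R) : 0 < d -> 0 < w ->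
    M e - w <= volume mu (c u) (e + 2 * d).
  move=> d0 w0; have [_ [v /= v0 <-] vM] := sup_adherent w0 (Vsup e).
  have [k [v' [vv' kv]]] := limit_c u v0 d0.
  apply: le_trans (ltW vM) _; apply: le_trans (volume_ray_le e v0 vv') _.
  rewrite -(volume_act haar_mu mu_right k).
  exact: (volume_near properX closedG haar_mu e kv).
set m0 := mdist (val g (c t)) (c t) in lt.
set m1 := mdist (val g (c s)) (c s) in lt.
(* The middle third between the two displacements: [g] itself then lies in the open set [W], which
   has positive measure [w]. *)
pose a := m0 + (m1 - m0) / 3; pose b := m0 + (m1 - m0) * 2 / 3.
have [m0a ab bm1] : [/\ m0 < a, a < b & b < m1] by rewrite /a /b; split; lra.
pose W := moves (G := G) (c t) (c t) (c s) (c s) a b.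
have W0 : W !=set0 by exists g; split; rewrite ?m0a.
pose w := fine (mu W).
have w0 : 0 < w.
  apply: fine_gt0; rewrite haar_moves_gt0 //=.
  apply: (@le_lt_trans _ _ (mu (transporter (c t) (c t) a))).
    apply: le_measure.
    - by apply/mem_set; apply: measurable_open; exact: open_moves.
    - by apply/mem_set; exact: measurable_transporter.
    - by move=> h [ha _]; rewrite /transporter /mkset ltW.
  by rewrite -ge0_fin_numE ?measure_ge0 // transporter_fin_num.
have w2 : 0 < w / 2 by rewrite divr_gt0.
(* Chaining [lower] at [c s], [volume_gap] at the middle radius [u + 2 * d] and [upper] at [c t]
   gives [M u + w / 2 <= M v]. *)
apply: (@no_uniform_jump _ M a b (w / 2) ab w2) => u v au uv vb.
pose d := (v - u) / 4; have d0 : 0 < d by rewrite divr_gt0 // subr_gt0.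
have := lower s u d (w / 2) d0 w2; have := upper t (u + 2 * d) d d0.
have -> : u + 2 * d + 2 * d = v by rewrite /d; field.
have ud : u + 2 * d <= b by rewrite /d; lra.
have ad : a <= u + 2 * d by lra.
have sub : transporter (G := G) (c s) (c s) (u + 2 * d) `<=`
    transporter (c t) (c t) (u + 2 * d).
  by move=> h; apply: le_trans; exact: nonincr_c.
have := volume_gap sub ad ud; rewrite -/W -/w; lra.
Qed.

End LimitLine.

(** * Fixed points at infinity *)

Section FixedPoint.
Context {R : realType} (X : metricType R) (G : groupClosed (Isom X)).
Hypotheses (properX : proper_space X) (catX : CAT0 X).

Lemma cocompact_bounded (x0 : X) : cocompact_action [set` G] ->
  exists D : R, forall x, exists k : subgroup G, mdist x0 (val k x) <= D.
Proof.
move=> [K cK KX].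
have : \forall D \near +oo, K `<=` (fun y => mdist x0 y <= D).
  apply: ((compact_near_coveringP K).1 cK _ +oo
    (fun (D : R) y => mdist x0 y <= D) _) => y Ky.
  exists ([set z | mdist y z < 1], [set D | mdist x0 y + 1 <= D]) => /=.
    split; last by apply: nbhs_pinfty_ge; exact: num_real.
    by apply/metricType_numDomainType.nbhs_mdistP; exists 1 => /=.
  move=> [z D] /= [yz]; apply: le_trans.
  by apply: le_trans (metric_triangle _ y _) _; rewrite lerD2l ltW.
move=> /filter_ex[D KD]; exists D => x.
have : [set: X] x by []; rewrite -KX => -[g Gg [y Ky <-]].
exists ((exist _ g Gg : subgroup G)^-1)%g.
by have := actV (exist _ g Gg : subgroup G) y => /= ->; exact: KD.
Qed.

Lemma isometry_asymptotic (f : Isom X) (r r' : R -> X) :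
  asymptotic r r' -> asymptotic (f \o r) (f \o r').
Proof. by move=> [M rM]; exists M => t t0 /=; rewrite isometry_mdist rM. Qed.

Lemma isometry_line (f : Isom X) (c : R -> X) :
  geodesic_line c -> geodesic_line (f \o c).
Proof. by move=> lc s t /=; rewrite isometry_mdist. Qed.

(* The limit of the rays [k n (r (n + s))], which all point to the same point
   at infinity and whose origins escape backwards. *)
Lemma fixed_ray_limit_line (r : R -> X) : geodesic_ray r ->
  (forall g : subgroup G, asymptotic (val g \o r) r) ->
  cocompact_action [set` G] ->
  exists c, [/\ geodesic_line c, asymptotic r c &
    forall s N e : R, 0 <= N -> 0 < e ->
      exists (k : subgroup G) (t : R), N <= t /\ mdist (val k (r t)) (c s) <= e].
Proof.
move=> rr fr /(cocompact_bounded (r 0))[D /choice[k kD]].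
have [U [UU ooU]] := ultraFilterLemma eventually_filter.
pose c n s := val (k (r n%:R)) (r (n%:R + s)).
have large s (N : R) : \forall n \near U, N <= n%:R + s.
  apply: ooU; apply: filterS (nbhs_infty_ger (N - s)) => n.
  by rewrite lerBlDr.
have c0D n : mdist (r 0) (c n 0) <= D by rewrite /c addr0.
have [c' lc' cc'] : exists2 c', geodesic_line c' &
    forall s, (fun n => c n s) @ U --> c' s.
  apply: (@ultra_limit_line _ _ properX _ U c (r 0) D UU).
    exact: nearW.
  (* For [n] large both [n + s] and [n + t] are nonnegative, where [r] is known to be isometric. *)
  move=> s t; apply: filterS2 (large s 0) (large t 0) => n s0 t0.
  by rewrite /c isometry_mdist rr ?in_itv /= ?s0 ?t0 //; congr `|_|; ring.
have ray n : geodesic_ray (c n).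
  move=> s t; rewrite !in_itv /= !andbT => s0 t0.
  by rewrite /c isometry_mdist rr ?in_itv /= ?addr_ge0 //; congr `|_|; ring.
have asr n : asymptotic (c n) r.
  have [M rM] := fr (k (r n%:R)); exists (n%:R + M) => t t0.
  apply: le_trans (metric_triangle _ (val (k (r n%:R)) (r t)) _) _.
  apply: lerD; last exact: rM.
  rewrite /c isometry_mdist rr ?in_itv /= ?addr_ge0 ?t0 //.
  by rewrite addrK ger0_norm.
exists c'; split=> //.
  (* The rays [c n] start within [D] of [r 0] and are mutually asymptotic, so they stay within
     [D + D] of each other. *)
  apply: (asymptotic_trans (asymptotic_sym (asr 0))); exists (D + D) => t t0.
  have cst : (fun=> c 0 t) @ U --> c 0 t by exact: cvg_cst.
  apply: cvg_mdist_le cst (cc' t) _; apply: nearW => n.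
  have as0 := asymptotic_trans (asr 0) (asymptotic_sym (asr n)).
  apply: le_trans (asymptotic_nonincreasing catX (ray 0) (ray n) as0 _ t0) _ => //.
  apply: le_trans (metric_triangle _ (r 0) _) _.
  by apply: lerD => //; rewrite metric_sym.
move=> s N e N0 e0.
have [n [nN ne]] := filter_ex (filterI (large s N)
  (metricType_numDomainType.cvgr_dist_le (cc' s) e0)).
by exists (k (r n%:R)), (n%:R + s); split=> //; rewrite metric_sym.
Qed.

(** Take a largest Euclidean factor among the splittings having [c] in one flat: [Q] holds at 1 and,
    by [splitting_bound], fails beyond some dimension. A line in the remaining factor would give a
    larger splitting with the same property. *)
Lemma line_euclidean_factor (c : R -> X) : geodesic_line c ->
  parallel_set c = [set: X] ->
  exists n (Y : metricType R) (phi : 'rV[R]_n -> Y -> X),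
    canonical_decomposition phi /\
    exists y, forall t, exists v, c t = phi v y.
Proof.
move=> lc cT; pose Q n := exists (Y : metricType R) (phi : 'rV[R]_n -> Y -> X),
  euclidean_splitting phi /\ exists y, forall t, exists v, c t = phi v y.
have Q1 : Q 1.
  have [Y [phi [phiS [y yE]]]] := parallel_set_splitting catX lc cT.
  by exists Y, phi; split=> //; exists y => t; exists (const_mx t).
have [N QN] := splitting_bound (c 0) properX.
have [n [Qn nQn]] : exists n, Q n /\ ~ Q n.+1.
  apply: contrapT => /forallNP nQ.
  have Qall n : Q n.+1.
    by elim: n => // n IH; have /not_andP[//|/contrapT] := nQ n.+1.
  by have [Y [phi [/QN]]] := Qall N; rewrite ltnn.
have [Y [phi [phiS [y yE]]]] := Qn; exists n, Y, phi; split; last by exists y.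
split=> // -[Z [psi psiS]]; apply: nQn; rewrite -addn1.
exists Z, (fun v z => phi (lsubmx v) (psi (rsubmx v) z)); split.
  exact: (splitting_add phiS psiS).
have [w [z wz]] := psiS.2 y; exists z => t; have [v ->] := yE t.
by exists (row_mx v w); rewrite row_mxKl row_mxKr wz.
Qed.

Lemma unimodular_fixed_line (r : R -> X) : closed [set` G] ->
  cocompact_action [set` G] -> minimal_action [set` G] ->
  unimodular R (subgroup G) -> geodesic_ray r ->
  (forall g : subgroup G, asymptotic (val g \o r) r) ->
  exists c, [/\ geodesic_line c, asymptotic r c & parallel_set c = [set: X]].
Proof.
move=> closedG cocG minG [mu [haar_mu mu_right]] rr fr.
have [c [lc rc limc]] := fixed_ray_limit_line rr fr cocG.
exists c; split=> //.
have nonincr (g : subgroup G) s t : s <= t ->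
    mdist (val g (c t)) (c t) <= mdist (val g (c s)) (c s).
  apply: (line_asymptotic_le catX (isometry_line (val g) lc) lc).
  apply: (asymptotic_trans _ rc); apply: (asymptotic_trans _ (fr g)).
  exact/isometry_asymptotic/asymptotic_sym.
have bounded : exists (x0 : X) (D : R), forall t : R, 0 <= t ->
    exists k : subgroup G, mdist (val k (r t)) x0 <= D.
  have [D rD] := cocompact_bounded (r 0) cocG; exists (r 0), D => t _.
  by have [k kD] := rD (r t); exists k; rewrite metric_sym.
have disp := limit_line_displacement properX catX closedG haar_mu mu_right rr
  fr limc bounded nonincr.
apply: minG.
- by exists (c 0), c; split=> //; exact: parallel_refl.
- exact: parallel_set_closed.
- exact: parallel_set_convex.
- move=> g _ Gg [c' [lc' cc' <-]]; exists (g \o c'); split=> //.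
    exact: isometry_line.
  (* [g \o c'] is parallel to [g \o c], itself parallel to [c] because [g] displaces all points of
     [c] by the same amount. *)
  have [M cM] := cc'.
  apply: (@parallel_trans _ _ _ (g \o c)); last first.
    by exists M => t /=; rewrite isometry_mdist.
  exists (mdist (g (c 0)) (c 0)) => t; rewrite metric_sym.
  by rewrite (disp (exist _ g Gg) 0 t).
Qed.

End FixedPoint.

Theorem theorem13 (R : realType) (X : metricType R)
    (G : groupClosed (Isom X)) :
  proper_space X -> CAT0 X ->
  closed [set` G] ->
  cocompact_action [set` G] ->
  minimal_action [set` G] ->
  unimodular R (subgroup G) ->
  forall xi : set (R -> X), visual_boundary X xi ->
    fixed_at_infinity [set` G] xi ->
    euclidean_factor_boundary X xi.
Proof.
move=> properX catX closedG cocG minG uniG _ [r rr <-] fixr.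
have fr (g : subgroup G) : asymptotic (val g \o r) r.
  have rxi : asymptote_class r r.
    by split=> //; exists 0 => t _; rewrite mdistxx.
  have : asymptote_class r (val g \o r).
    by rewrite -{1}(fixr (val g) (actE g)); exists r.
  by case=> _ /asymptotic_sym.
have [c [lc rc cT]] :=
  unimodular_fixed_line properX catX closedG cocG minG uniG rr fr.
split; first by exists r.
have [n [Y [phi [phiC [y yE]]]]] := line_euclidean_factor properX catX lc cT.
(* The half of [c] with nonnegative parameters represents the given point at infinity and stays in
   one flat. *)
exists n, Y, phi; split=> //; exists c; last by exists y => t _.
by split=> // s t _ _; exact: lc.
Qed.
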